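(* Let $n\in\mathbb{N}$ and $G=G(5,n)$ with vertex set $V=\{2,4,\ldots,2n\}$. Let $X=\{x\in V: x\equiv 0\pmod 4\}$, $Y=\{y\in V: y\equiv 2\pmod 4\}$, and define $A=\{x\in X: x\equiv 0\pmod 5\}$, $D=\{x\in X: x\equiv \pm1\pmod 5\}$, $E=\{x\in X: x\equiv \pm 2\pmod 5\}$, $F=\{y\in Y: y\equiv 0\pmod 5\}$, $B=\{y\in Y: y\equiv \pm1\pmod 5\}$, $C=\{y\in Y: y\equiv \pm 2\pmod 5\}$. Then there is an ordering of the vertices of $G$ such that the biadjacency matrix of $G$, with rows indexed by $F,B,C$ (in this order) and columns by $A,D,E$ (in this order), has the block form $$\begin{pmatrix}\mathbf{0}&\mathbf{1}&\mathbf{1}\\ \mathbf{1}&A_1&\mathbf{1}\\ \mathbf{1}&\mathbf{1}&A_2\end{pmatrix},$$ where $\mathbf{0}$ denotes an all-zeros block, $\mathbf{1}$ an all-ones block, and $A_1$ (rows $B$, columns $D$) and $A_2$ (rows $C$, columns $E$) are path matrices.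
   Context: For a prime $p$ and $n\in\mathbb{N}$, $G(p,n)$ is the simple graph with vertex set $\{2,4,\ldots,2n\}$ in which two distinct vertices $a,b$ are adjacent if and only if both $\frac{a+b}{2}$ and $\frac{|a-b|}{2}$ are odd positive integers neither of which equals $pk$ for an integer $k\ge 2$. The biadjacency matrix has rows indexed by vertices of $Y$ and columns by vertices of $X$, with entry $1$ exactly when they are adjacent. A path matrix is the biadjacency matrix of a path graph (with its bipartition) when the vertices of each part are listed in the order in which they occur along the path. *)

(* Defs.v *)
From mathcomp Require Import all_boot all_order all_algebra.

Set Implicit Arguments.
Unset Strict Implicit.
Unset Printing Implicit Defensive.

Local Open Scope ring_scope.

Section Bipartite.

Variables (T : finType) (adj : T -> T -> Prop).

Definition independent (s : seq T) : Prop :=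
  forall u v, u \in s -> v \in s -> ~ adj u v.

Definition bipartition (rows cols : seq T) : Prop :=
  [/\ perm_eq (rows ++ cols) (enum T), independent rows & independent cols].

Definition is_biadjacency_mx (r c : nat) (rows : r.-tuple T)
    (cols : c.-tuple T) (M : 'M[int]_(r, c)) : Prop :=
  bipartition rows cols /\
  forall i j, (adj (tnth rows i) (tnth cols j) -> M i j = 1) /\
              (~ adj (tnth rows i) (tnth cols j) -> M i j = 0).

Definition ordering_of (S : {set T}) (s : #|S|.-tuple T) : Prop :=
  perm_eq s (enum S).

End Bipartite.

(* The path on m vertices is 0 - 1 - ... - m.-1, so that the order of
   occurrence along the path is the order of 'I_m.  The path may start in
   either part, and m = 0 (the 0 x 0 matrix) and m = 1 (an empty matrix with a
   single row or a single column) are allowed. *)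
Definition path_adj (m : nat) (i j : 'I_m) : Prop :=
  (i.+1 = j :> nat) \/ (j.+1 = i :> nat).

Definition path_matrix (r c : nat) (M : 'M[int]_(r, c)) : Prop :=
  exists m (rows : r.-tuple 'I_m) (cols : c.-tuple 'I_m),
    [/\ sorted ltn (map val rows), sorted ltn (map val cols)
      & is_biadjacency_mx (@path_adj m) rows cols M].

Local Open Scope nat_scope.

Definition vertices (n : nat) : seq nat := [seq 2 * i | i <- iota 1 n].

Notation vertex n := (seq_sub (vertices n)).

Definition admissible (p m : nat) : Prop :=
  [/\ odd m, 0 < m & forall k, 2 <= k -> m <> p * k].

(* Vertices are even, so both halves are exact. *)
Definition G_adj (p n : nat) (a b : vertex n) : Prop :=
  [/\ a <> b, admissible p ((val a + val b) %/ 2)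
    & admissible p (`|(val a)%:Z - (val b)%:Z| %/ 2)].

Definition partX n : {set vertex n} := [set x | val x == 0 %[mod 4]].
Definition partY n : {set vertex n} := [set y | val y == 2 %[mod 4]].

(* Modulo 5, -1 and -2 are 4 and 3. *)
Definition classA n := [set x in partX n | val x == 0 %[mod 5]].
Definition classD n :=
  [set x in partX n | (val x == 1 %[mod 5]) || (val x == 4 %[mod 5])].
Definition classE n :=
  [set x in partX n | (val x == 2 %[mod 5]) || (val x == 3 %[mod 5])].
Definition classF n := [set y in partY n | val y == 0 %[mod 5]].
Definition classB n :=
  [set y in partY n | (val y == 1 %[mod 5]) || (val y == 4 %[mod 5])].
Definition classC n :=
  [set y in partY n | (val y == 2 %[mod 5]) || (val y == 3 %[mod 5])].

(* Main.v *)
(** Writing vertices as [2 * i], the vertices [2 * i] and [2 * j] are adjacent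
    iff [i + j] is odd and neither [i + j] nor [|i - j|] is a multiple of 5
    larger than 5.  If [i] and [j] lie in different classes modulo 5 up to sign,
    neither number is divisible by 5; if both are divisible by 5, then [i + j]
    is at least 15.  If [i = j] or [i = -j] modulo 5 and both are prime to 5,
    adjacency means [i + j = 5] or [|i - j| = 5], so the indices that are [c] or
    [- c] modulo 5 form the path
    [..., c + 10, c + 5, c, 5 - c, 10 - c, 15 - c, ...], and the parity
    alternates along it. *)
Require Import Defs.
From mathcomp Require Import all_boot all_order all_algebra.
From mathcomp Require Import zify.

Set Implicit Arguments.
Unset Strict Implicit.
Unset Printing Implicit Defensive.

Local Open Scope ring_scope.

Section PathOrderings.

Variables (T : finType) (e : rel T) (m : nat) (v : 'I_m -> T).
Variables (S1 S2 : {set T}).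

Lemma image_filter_perm (S : {set T}) :
  injective v -> (forall x, x \in S -> exists q, x = v q) ->
  perm_eq [seq v q | q <- enum 'I_m & v q \in S] (enum S).
Proof.
move=> v_inj Sv; apply: uniq_perm; last 1 first.
- move=> x; rewrite mem_enum; apply/mapP/idP => [[q]|xS].
    by rewrite mem_filter => /andP[qS _] ->.
  have [q def_x] := Sv x xS; exists q => //.
  by rewrite mem_filter -def_x xS mem_enum.
- by rewrite map_inj_uniq // filter_uniq // enum_uniq.
- exact: enum_uniq.
Qed.

Lemma sorted_filter_enum_ord (a : pred 'I_m) :
  sorted ltn (map val [seq q <- enum 'I_m | a q]).
Proof.
apply: (subseq_sorted ltn_trans (s2 := map val (enum 'I_m))).
  exact/map_subseq/filter_subseq.
by rewrite val_enum_ord iota_ltn_sorted.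
Qed.

(** The map [v] carries the path on ['I_m] onto the union of [S1] and [S2]. Keeping the positions
    that fall in each set, in increasing order, lists both sets in path order; since path edges
    change set, these are the two parts of the path. *)
Lemma path_orderings :
  injective v ->
  (forall x, x \in S1 -> exists q, x = v q) ->
  (forall x, x \in S2 -> exists q, x = v q) ->
  (forall q, (v q \in S2) = (v q \notin S1)) ->
  (forall q r, v q \in S1 -> v r \in S2 -> e (v q) (v r) <-> path_adj q r) ->
  (forall q r, path_adj q r -> (v q \in S1) = (v r \notin S1)) ->
  exists (s1 : #|S1|.-tuple T) (s2 : #|S2|.-tuple T),
    [/\ ordering_of s1, ordering_of s2
      & path_matrix (\matrix_(i, j) (e (tnth s1 i) (tnth s2 j))%:R)].
Proof.
move=> v_inj S1v S2v S2E eE alt.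
pose r1 := [seq q <- enum 'I_m | v q \in S1].
pose r2 := [seq q <- enum 'I_m | v q \in S2].
have p1 : perm_eq (map v r1) (enum S1) by apply: image_filter_perm.
have p2 : perm_eq (map v r2) (enum S2) by apply: image_filter_perm.
have sz1 : size r1 == #|S1| by rewrite cardE -(perm_size p1) size_map.
have sz2 : size r2 == #|S2| by rewrite cardE -(perm_size p2) size_map.
exists (map_tuple v (Tuple sz1)), (map_tuple v (Tuple sz2)).
split=> //; exists m, (Tuple sz1), (Tuple sz2).
have in1 q : q \in r1 -> v q \in S1 by rewrite mem_filter => /andP[].
have in2 q : q \in r2 -> v q \in S2 by rewrite mem_filter => /andP[].
split; [exact: sorted_filter_enum_ord | exact: sorted_filter_enum_ord |].
split; first split.
- rewrite /bipartition /=; have -> : r2 = [seq q <- enum 'I_m | predC (fun q => v q \in S1) q].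
    by apply: eq_filter => q /=; rewrite S2E.
  by rewrite perm_filterC.
- by move=> q r /in1 q1 /in1 r1' /alt; rewrite q1 r1'.
- move=> q r /in2; rewrite S2E => /negbTE q1 /in2.
  by rewrite S2E => r1' /alt; rewrite q1 r1'.
move=> i j; rewrite mxE !tnth_map.
have := eE _ _ (in1 _ (mem_tnth i (Tuple sz1))) (in2 _ (mem_tnth j (Tuple sz2))).
case: (e _ _) => -[h1 h2]; split=> // h; first by case: h; apply: h1.
by have := h2 h.
Qed.

End PathOrderings.

Lemma count_mem_ordering (T : finType) (S : {set T}) (s : #|S|.-tuple T) x :
  ordering_of s -> count_mem x s = (x \in S).
Proof. by move/permP->; rewrite count_uniq_mem ?enum_uniq // mem_enum. Qed.

Lemma mem_ordering (T : finType) (S : {set T}) (s : #|S|.-tuple T) :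
  ordering_of s -> s =i S.
Proof. by move=> /perm_mem eq_s x; rewrite eq_s mem_enum. Qed.

Local Open Scope nat_scope.

(** Oddness rules out the multiple 0, so [5] itself is the only multiple of 5 that avoids [5 * k]
    for all [k >= 2]. *)
Lemma admissible5E m : admissible 5 m <-> odd m && ((m == 5) || ~~ (5 %| m)).
Proof.
split=> [[om _ mk]|/andP[om m5]].
  rewrite om /=; case: eqP => //= m5; apply/negP => /dvdnP[k def_m].
  by apply: (mk k); lia.
split=> //; first by lia.
by move=> k k2 def_m; move: m5; rewrite def_m dvdn_mulr //; lia.
Qed.

Section Vertices.

Variable n : nat.
Implicit Types x y : vertex n.

Lemma mem_vertices i : (2 * i \in vertices n) = (0 < i <= n).
Proof.
rewrite mem_map; last by move=> a b; lia.
by rewrite mem_iota; lia.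
Qed.

Lemma vertexP x : exists2 i, val x = 2 * i & 0 < i <= n.
Proof.
case: x => a /= a_n; case/mapP: (a_n) => i _ def_a.
by exists i => //; rewrite -mem_vertices -def_a.
Qed.

(** The sum and the difference of [i] and [j] have the same parity, so one oddness test serves both
    and also forces [x <> y]. *)
Lemma G_adj5E x y i j : val x = 2 * i -> val y = 2 * j ->
  G_adj 5 x y <->
  [&& odd (i + j), (i + j == 5) || ~~ (5 %| i + j)
    & ((i == j + 5) || (j == i + 5)) || (i != j %[mod 5])].
Proof.
move=> xi yj; rewrite /G_adj xi yj.
have -> : (2 * i + 2 * j) %/ 2 = i + j by lia.
have -> : `|(2 * i)%:Z - (2 * j)%:Z| %/ 2 = (i - j) + (j - i) by lia.
split=> [[_ /admissible5E + /admissible5E]|h]; first by lia.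
split; [by move=> eq_xy; move: xi; rewrite eq_xy yj; lia | |].
  by apply/admissible5E; lia.
by apply/admissible5E; lia.
Qed.

(** Boolean form of adjacency inside the blocks [A1] and [A2], usable as a matrix entry. *)
Definition half_sum_or_diff_5 : rel (vertex n) := fun x y =>
  [|| val x + val y == 10, val x == val y + 10 | val y == val x + 10].

(* [path_index c q] is the half of the [q]-th vertex of the path through the
   vertices [2 * i] with [i <= n] equal to [c] or [- c] modulo 5; there are
   [(n + 5 - c) %/ 5] of the first kind. *)
Definition path_index c q :=
  let l := (n + 5 - c) %/ 5 in
  if q < l then 5 * (l - q.+1) + c else 5 * (q - l) + (5 - c).

Definition path_length c := (n + 5 - c) %/ 5 + (n + c) %/ 5.

(** The second summand of [path_length] counts the [5 * k + (5 - c)] up to [n], so neither branch of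
    [path_index] exceeds [n]. *)
Lemma path_index_bound c (q : 'I_(path_length c)) : 0 < c < 3 ->
  2 * path_index c q \in vertices n.
Proof.
move=> c3; rewrite mem_vertices /path_index.
by have := ltn_ord q; rewrite /path_length; case: ifP; lia.
Qed.

Definition path_vertex c (c3 : 0 < c < 3) (q : 'I_(path_length c)) : vertex n :=
  SeqSub (path_index_bound q c3).

Lemma path_class_orderings c (S1 S2 : {set vertex n}) : 0 < c < 3 ->
  (forall x i, val x = 2 * i ->
     (x \in S1) = odd i && ((i == c %[mod 5]) || (i == 5 - c %[mod 5]))) ->
  (forall x i, val x = 2 * i ->
     (x \in S2) = ~~ odd i && ((i == c %[mod 5]) || (i == 5 - c %[mod 5]))) ->
  exists (s1 : #|S1|.-tuple (vertex n)) (s2 : #|S2|.-tuple (vertex n)),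
    [/\ ordering_of s1, ordering_of s2
      & path_matrix
          (\matrix_(i, j) (half_sum_or_diff_5 (tnth s1 i) (tnth s2 j))%:R)].
Proof.
move=> c3 S1E S2E.
have surj x i : val x = 2 * i ->
    (i == c %[mod 5]) || (i == 5 - c %[mod 5]) -> exists q, x = path_vertex c3 q.
  move=> xi ic; have [i' xi' i'n] := vertexP x.
  have {i' xi' i'n} i_n : 0 < i <= n by lia.
  pose l := (n + 5 - c) %/ 5.
  (* Inverse of [path_index]: [5 * k + c] sits [k + 1] places before position [l], and
     [5 * k + (5 - c)] sits [k] places after it. *)
  pose q := if i == c %[mod 5] then l - (i %/ 5).+1 else l + i %/ 5.
  have q_lt : q < path_length c.
    by rewrite /q /path_length -/l; case: eqP ic; rewrite /l; lia.
  exists (Ordinal q_lt); apply: val_inj; rewrite xi /= /path_index -/l /q.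
  by case: eqP ic => /= ? ?; case: ifP; rewrite /l; lia.
have modE q : (path_index c q == c %[mod 5]) || (path_index c q == 5 - c %[mod 5]).
  by rewrite /path_index; case: ifP; lia.
have S1v q : (path_vertex c3 q \in S1) = odd (path_index c q).
  by rewrite (S1E _ (path_index c q)) // modE andbT.
have S2v q : (path_vertex c3 q \in S2) = ~~ odd (path_index c q).
  by rewrite (S2E _ (path_index c q)) // modE andbT.
apply: (@path_orderings _ _ _ (path_vertex c3)).
- move=> q r /(congr1 val) /= eq_qr; apply: val_inj => /=.
  by move: eq_qr; rewrite /path_index; do 2 case: ifP; lia.
- move=> x; have [i xi _] := vertexP x.
  by rewrite (S1E _ _ xi) => /andP[_]; apply: surj.
- move=> x; have [i xi _] := vertexP x.
  by rewrite (S2E _ _ xi) => /andP[_]; apply: surj.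
- by move=> q; rewrite S1v S2v.
- move=> q r; rewrite S1v S2v /half_sum_or_diff_5 /path_adj /=.
  by rewrite /path_index; do 2 case: ifP; lia.
- move=> q r; rewrite !S1v /path_adj.
  by rewrite /path_index; do 2 case: ifP; lia.
Qed.

End Vertices.

Local Open Scope ring_scope.

Theorem theorem5p3 (n : nat) :
  exists (sF : #|classF n|.-tuple (vertex n))
         (sB : #|classB n|.-tuple (vertex n))
         (sC : #|classC n|.-tuple (vertex n))
         (sA : #|classA n|.-tuple (vertex n))
         (sD : #|classD n|.-tuple (vertex n))
         (sE : #|classE n|.-tuple (vertex n))
         (A1 : 'M[int]_(#|classB n|, #|classD n|))
         (A2 : 'M[int]_(#|classC n|, #|classE n|)),
    [/\ ordering_of sF, ordering_of sB & ordering_of sC] /\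
    [/\ ordering_of sA, ordering_of sD & ordering_of sE] /\
    path_matrix A1 /\ path_matrix A2 /\
    is_biadjacency_mx (@G_adj 5 n)
      (cat_tuple sF (cat_tuple sB sC))
      (cat_tuple sA (cat_tuple sD sE))
      (block_mx (const_mx 0) (row_mx (const_mx 1) (const_mx 1))
                (col_mx (const_mx 1) (const_mx 1))
                (block_mx A1           (const_mx 1)
                          (const_mx 1) A2)).
Proof.
(* Halving modulo 5 exchanges the classes of 1 and 2 up to sign: [2 * i] is 1 or -1 iff [i] is 2 or
   -2. Hence [c = 2] for [B], [D] and [c = 1] for [C], [E]. *)
have [| | |sB [sD [oB oD pA1]]] := @path_class_orderings n 2 (classB n) (classD n).
- by [].
- by move=> x i xi; rewrite !inE xi; lia.
- by move=> x i xi; rewrite !inE xi; lia.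
have [| | |sC [sE [oC oE pA2]]] := @path_class_orderings n 1 (classC n) (classE n).
- by [].
- by move=> x i xi; rewrite !inE xi; lia.
- by move=> x i xi; rewrite !inE xi; lia.
(* All blocks meeting [F] or [A] are constant, so any order of these two classes will do. *)
pose sF := enum_tuple (classF n); pose sA := enum_tuple (classA n).
have oF : ordering_of sF by exact: perm_refl.
have oA : ordering_of sA by exact: perm_refl.
exists sF, sB, sC, sA, sD, sE; do 2!eexists.
split; first by split.
split; first by split.
split; first exact: pA1.
split; first exact: pA2.
have memY x : x \in cat_tuple sF (cat_tuple sB sC) -> x \in partY n.
  rewrite !mem_cat (mem_ordering oF) (mem_ordering oB) (mem_ordering oC).
  by rewrite !inE; lia.
have memX x : x \in cat_tuple sA (cat_tuple sD sE) -> x \in partX n.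
  rewrite !mem_cat (mem_ordering oA) (mem_ordering oD) (mem_ordering oE).
  by rewrite !inE; lia.
split; first split.
(* Each vertex lies in exactly one of the six classes, as its residues modulo 4 and 5 show. *)
- apply/allP => x _; rewrite /= !count_cat !count_mem_ordering //.
  rewrite count_uniq_mem ?enum_uniq // mem_enum !inE.
  have [i -> _] := vertexP x.
  have m4 : ((2 * i) %% 4 = 0 \/ (2 * i) %% 4 = 2)%N by lia.
  have := ltn_pmod (2 * i) (isT : 0 < 5)%N.
  by case: m4 => ->; case: (_ %% 5)%N => [|[|[|[|[|]]]]].
(* Within one part the halves have equal parity, so their sum is even. *)
- move=> x y /memY + /memY; rewrite !inE.
  have [i xi _] := vertexP x; have [j yj _] := vertexP y.
  by rewrite (G_adj5E xi yj) xi yj; lia.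
- move=> x y /memX + /memX; rewrite !inE.
  have [i xi _] := vertexP x; have [j yj _] := vertexP y.
  by rewrite (G_adj5E xi yj) xi yj; lia.
(* Each block reduces to comparing adjacency with a boolean relation [b]. Positivity of the halves
   is what excludes a sum of 5 in the block of [F] and [A]. *)
have entry (S S' : {set vertex n}) (s : #|S|.-tuple _) (s' : #|S'|.-tuple _)
    (b : rel (vertex n)) : ordering_of s -> ordering_of s' ->
    (forall x y k l, x \in S -> y \in S' -> val x = (2 * k)%N ->
       val y = (2 * l)%N -> (0 < k)%N -> (0 < l)%N -> G_adj 5 x y <-> b x y) ->
    forall i j (M : int), M = (b (tnth s i) (tnth s' j))%:R ->
    (G_adj 5 (tnth s i) (tnth s' j) -> M = 1) /\
    (~ G_adj 5 (tnth s i) (tnth s' j) -> M = 0).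
  move=> os os' adjE i j M ->.
  have [k xk /andP[k0 _]] := vertexP (tnth s i).
  have [l yl /andP[l0 _]] := vertexP (tnth s' j).
  have := adjE _ _ k l _ _ xk yl k0 l0.
  rewrite -(mem_ordering os) -(mem_ordering os') !mem_tnth => /(_ isT isT).
  by case: (b _ _) => -[h1 h2]; split=> // h; [case: h; apply: h2 | have := h1 h].
move=> i j.
(* The nine blocks follow row by row, each with its own [b]. *)
case: (split_ordP i) => {i}[i ->|i ->]; last case: (split_ordP i) => {i}[i ->|i ->];
  (case: (split_ordP j) => {j}[j ->|j ->]; last case: (split_ordP j) => {j}[j ->|j ->]);
  rewrite ?(block_mxEul, block_mxEur, block_mxEdl, block_mxEdr)
          ?(row_mxEl, row_mxEr, col_mxEu, col_mxEd) mxE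
          ?(tnth_lshift, tnth_rshift);
  [ apply: (entry _ _ _ _ (fun _ _ => false)) => //
  | apply: (entry _ _ _ _ (fun _ _ => true)) => //
  | apply: (entry _ _ _ _ (fun _ _ => true)) => //
  | apply: (entry _ _ _ _ (fun _ _ => true)) => //
  | apply: (entry _ _ _ _ (@half_sum_or_diff_5 n)) => //
  | apply: (entry _ _ _ _ (fun _ _ => true)) => //
  | apply: (entry _ _ _ _ (fun _ _ => true)) => //
  | apply: (entry _ _ _ _ (fun _ _ => true)) => //
  | apply: (entry _ _ _ _ (@half_sum_or_diff_5 n)) => //];
  move=> {i j} x y k l + + xk yl; rewrite (G_adj5E xk yl) !inE
    /half_sum_or_diff_5 xk yl; lia.
Qed.
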